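(* Let $R$ be a ring with unity, let $k\in\mathbb{N}$ and let $G=\mathbb{N}^k$ (with componentwise addition). A generalized algebraic persistence module over $R$ indexed by $\mathbb{N}^k$ is of finite type if and only if every sequence in it becomes stationary.
   Context: $\mathbb{N}=\{0,1,2,\dots\}$. Rings have a unity and need not be commutative; modules are left modules. On the monoid $G=(\mathbb{N}^k,+)$ write $g_1\preceq g_2$ if there is $h\in G$ with $h+g_1=g_2$. A generalized algebraic persistence module (GAPM) over $R$ indexed by $G$ is a tuple $\mathcal{M}_G=((M_g)_{g\in G},(\varphi_{g_1,g_2})_{g_1\preceq g_2\in G})$ where each $M_g$ is an $R$-module, each $\varphi_{g_1,g_2}:M_{g_1}\to M_{g_2}$ is an $R$-module morphism, $\varphi_{g,g}=1_{M_g}$, and $\varphi_{g_1,g_3}=\varphi_{g_2,g_3}\circ\varphi_{g_1,g_2}$ for all $g_1\preceq g_2\preceq g_3$. For $g\in G$, an element $h\in G$ is a frame of $g$ (with respect to $\mathcal{M}_G$) if $h\preceq g$ and $\varphi_{h,\tilde g}$ is an isomorphism for all $\tilde g$ with $h\preceq\tilde g\preceq g$. A subset $H\subseteq G$ is a framing set of $\mathcal{M}_G$ if every $g\in G$ has a frame in $H$. $\mathcal{M}_G$ is of finite type if it has a finite framing set. A sequence in $G$ is a family $(g_i)_{i\in\mathbb{N}}$ of elements of $G$ with $g_i\preceq g_{i+1}$ for all $i$. It induces the sequence $(M_{g_i})_{i\in\mathbb{N}}$ in $\mathcal{M}_G$ with connecting morphisms $\varphi_{g_i,g_{i+1}}$;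 this sequence becomes stationary if there is $D\in\mathbb{N}$ such that $\varphi_{g_i,g_{i+1}}$ is an isomorphism for all $i\ge D$. *)

(* Defs.v *)
From mathcomp Require Import all_boot all_order all_algebra.
From mathcomp Require Import classical_sets cardinality.

Set Implicit Arguments.
Unset Strict Implicit.
Unset Printing Implicit Defensive.

Import GRing.Theory.
Local Open Scope ring_scope.

Definition preceq (G : nmodType) (g1 g2 : G) : Prop := exists h : G, h + g1 = g2.

(* The scalars form a [pzRingType]: a possibly noncommutative unital ring,
   where 1 = 0 is allowed.
   The maps are indexed by proofs of [preceq g1 g2]. Since [gapm_id] and
   [gapm_comp] hold for all such proofs, they force the map to depend on g1 and
   g2 only: apply [gapm_comp] with g2 := g1. *)
Record gapm (R : pzRingType) (G : nmodType) := GAPM {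
  gapm_obj :> G -> lmodType R;
  gapm_map : forall g1 g2 : G, preceq g1 g2 ->
    {linear gapm_obj g1 -> gapm_obj g2};
  gapm_id : forall (g : G) (gg : preceq g g) (x : gapm_obj g),
    gapm_map gg x = x;
  gapm_comp : forall (g1 g2 g3 : G) (g12 : preceq g1 g2) (g23 : preceq g2 g3)
      (g13 : preceq g1 g3) (x : gapm_obj g1),
    gapm_map g13 x = gapm_map g23 (gapm_map g12 x)
}.

Definition is_iso (R : pzRingType) (U V : lmodType R) (f : {linear U -> V}) : Prop :=
  exists f' : {linear V -> U}, cancel f f' /\ cancel f' f.

Section FiniteType.
Variables (R : pzRingType) (G : nmodType) (M : gapm R G).

Definition frame (h g : G) : Prop :=
  preceq h g /\
  forall (g' : G) (hg' : preceq h g'), preceq g' g -> is_iso (gapm_map M hg').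

Definition framing_set (H : set G) : Prop :=
  forall g : G, exists h : G, H h /\ frame h g.

Definition finite_type : Prop :=
  exists H : set G, finite_set H /\ framing_set H.

Definition becomes_stationary (g : nat -> G)
    (gS : forall i : nat, preceq (g i) (g i.+1)) : Prop :=
  exists D : nat, forall i : nat, (D <= i)%N -> is_iso (gapm_map M (gS i)).

End FiniteType.

(* Main.v *)
Require Import Defs.
From mathcomp Require Import all_boot all_order all_algebra.
From mathcomp Require Import boolp classical_sets cardinality.

(** Both directions rest on one remark: if h is a frame of g, then all the maps
    of the module between comparable points of the interval from h to g are
    isomorphisms, because an isomorphism that factors as an isomorphism
    followed by a second map makes that second map an isomorphism
    ([iso_cancel]).

    If H is a finite framing set, then some h in H is a frame of infinitely many
    terms of a given sequence ([pigeonhole_infinitely_often]). From the first of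
    these terms on, every step of the sequence lies in an interval from h to a
    later such term, so it is an isomorphism. This holds over every commutative
    monoid ([finite_type_stationary]).

    Conversely, if no finite set is framing, choose greedily points u 0, u 1,
    and so on, such that no earlier point is a frame of u n. By Dickson's lemma
    ([dickson]) a subsequence of u increases for [preceq]. Between two
    consecutive terms v n and v (n + 1) of it there is a point w n for which the
    map from v n to w n is not an isomorphism, since v n is not a frame of
    v (n + 1). The sequence v 0, w 0, v 1, w 1, and so on, is then not
    stationary. Of the monoid N^k, this uses only Dickson's lemma
    ([stationary_finite_type]). *)

Set Implicit Arguments.
Unset Strict Implicit.
Unset Printing Implicit Defensive.

Import GRing.Theory.
Local Open Scope classical_set_scope.

Lemma preceq_refl (G : nmodType) (a : G) : preceq a a.
Proof. by exists 0%R; rewrite add0r. Qed.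

Lemma preceq_trans (G : nmodType) (b a c : G) :
  preceq a b -> preceq b c -> preceq a c.
Proof. by move=> [x <-] [y <-]; exists (y + x)%R; rewrite addrA. Qed.

Lemma preceq_homo (G : nmodType) (g : nat -> G) :
  (forall i, preceq (g i) (g i.+1)) ->
  forall i j, i <= j -> preceq (g i) (g j).
Proof.
by move=> gS; apply: homo_leq gS; [exact: preceq_refl | exact: preceq_trans].
Qed.

Lemma preceq_ffun_nat (I : finType) (a b : {ffun I -> nat}) :
  (forall i, a i <= b i) -> preceq a b.
Proof.
by move=> ab; exists [ffun i => b i - a i]; apply/ffunP => i;
  rewrite !ffunE; exact: subnK.
Qed.

Lemma pigeonhole_infinitely_often (T : eqType) (s : seq T)
    (P : T -> nat -> Prop) :
  (forall n, exists2 h, h \in s & P h n) ->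
  exists h, forall N, exists2 n, N <= n & P h n.
Proof.
move=> sP; apply: contrapT => /forallNP noh.
have /choice [B BP] : forall h, exists N, forall n, N <= n -> ~ P h n.
  move=> h; have /existsNP [N NP] := noh h.
  by exists N => n Nn Pn; apply: NP; exists n.
have [h hs Ph] := sP (\max_(h <- s) B h).
by apply: BP Ph; exact: leq_bigmax_seq.
Qed.

(** * Dickson's lemma *)

(** An index n is kept when u n is minimal among the later values; such indices
    occur arbitrarily late because every tail of u attains its minimum. *)
Lemma nat_nondecreasing_subseq (u : nat -> nat) :
  exists2 f : nat -> nat, forall n, f n < f n.+1 &
    forall n, u (f n) <= u (f n.+1).
Proof.
have /choice [r rP] : forall N, exists n,
    N <= n /\ forall m, n <= m -> u n <= u m.
  move=> N.
  have exv : exists v, `[< exists2 n, N <= n & u n = v >].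
    by exists (u N); apply/asboolP; exists N.
  case: (ex_minnP exv) => v /asboolP [n Nn <-] min; exists n; split => // m nm.
  by apply: min; apply/asboolP; exists m => //; exact: leq_trans nm.
pose f := fix f n := if n is m.+1 then r (f m).+1 else r 0.
have f_lt n : f n < f n.+1 by have [] := rP (f n).+1.
exists f => // n.
have [m fn] : exists m, f n = r m.
  by case: n => [|n]; [exists 0 | exists (f n).+1].
by have [_ min] := rP m; rewrite fn; apply: min; rewrite -fn; exact: ltnW.
Qed.

(** The extraction is made for one coordinate after the other; passing to a
    further subsequence keeps the coordinates already treated monotone. *)
Lemma dickson (I : finType) (u : nat -> {ffun I -> nat}) :
  exists2 f : nat -> nat, forall n, f n < f n.+1 &
    forall n, preceq (u (f n)) (u (f n.+1)).
Proof.
suff [f fS fP] : exists2 f : nat -> nat, forall n, f n < f n.+1 &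
    forall n i, i \in enum I -> u (f n) i <= u (f n.+1) i.
  by exists f => // n; apply: preceq_ffun_nat => i; apply: fP; rewrite mem_enum.
elim: (enum I) => [|i s [f fS fP]]; first by exists id.
have [g gS gP] := nat_nondecreasing_subseq (fun n => u (f n) i).
exists (f \o g) => [n | n j] /=; first exact: (homo_ltn ltn_trans fS).
rewrite inE => /predU1P[-> // | js].
by apply: (homo_leq (f := fun n => u (f n) j) leqnn leq_trans) (ltnW (gS n))
  => m; exact: fP.
Qed.

(** * Finite type and stationary sequences *)

Section PersistenceModule.
Variables (R : pzRingType) (G : nmodType) (M : gapm R G).

(** Quantifying over the proofs of [preceq a b] keeps the points a and b free
    to be rewritten. *)
Definition iso_between (a b : G) : Prop :=
  forall ab : preceq a b, is_iso (gapm_map M ab).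

Lemma gapm_map_irrelevance (a b : G) (p q : preceq a b) :
  gapm_map M p =1 gapm_map M q.
Proof.
by move=> x; rewrite (gapm_comp (preceq_refl a) q) gapm_id.
Qed.

Lemma is_iso_between (a b : G) (ab : preceq a b) :
  is_iso (gapm_map M ab) -> iso_between a b.
Proof.
move=> [f [fK Kf]] ab'; exists f.
by split=> x; rewrite (gapm_map_irrelevance ab' ab).
Qed.

Lemma iso_cancel (a b c : G) : preceq a b -> preceq b c ->
  iso_between a b -> iso_between a c -> iso_between b c.
Proof.
move=> ab bc ab_iso ac_iso bc'.
have [p [pK Kp]] := ab_iso ab.
have [q [qK Kq]] := ac_iso (preceq_trans ab bc).
have ac x : gapm_map M bc' (gapm_map M ab x) =
    gapm_map M (preceq_trans ab bc) x.
  by rewrite -(gapm_comp ab bc' (preceq_trans ab bc)).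
exists (gapm_map M ab \o q : {linear _ -> _}); split=> x /=.
  by rewrite -{1}[x]Kp ac qK Kp.
by rewrite ac Kq.
Qed.

Theorem finite_type_stationary : finite_type M ->
  forall (g : nat -> G) (gS : forall i, preceq (g i) (g i.+1)),
    becomes_stationary M gS.
Proof.
move=> [H [/finite_seqP [s ->] sP]] g gS.
have [|h hP] := @pigeonhole_infinitely_often _ s (fun h n => frame M h (g n)).
  by move=> n; have [h [hs hg]] := sP (g n); exists h.
have [D _ [hD _]] := hP 0; exists D => i Di.
have [j ij [_ hj]] := hP i.+1.
have g_homo := preceq_homo gS.
have iso_h n : D <= n -> n <= j -> iso_between h (g n).
  by move=> Dn nj hn; apply: hj; exact: g_homo.
apply: (@iso_cancel h) => //; first exact: preceq_trans (g_homo _ _ Di).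
- by apply: iso_h => //; exact: ltnW.
- by apply: iso_h => //; exact: leqW.
Qed.

Lemma nonframe_witness (h g : G) : preceq h g -> ~ frame M h g ->
  exists w, [/\ preceq h w, preceq w g & ~ iso_between h w].
Proof.
move=> hg nfr; apply: contrapT => /forallNP noW; apply: nfr; split=> // w hw wg.
by apply: contrapT => niso; apply: (noW w); split=> // /(_ hw).
Qed.

Lemma nonframed_sequence : ~ finite_type M ->
  exists u : nat -> G, forall m n, m < n -> ~ frame M (u m) (u n).
Proof.
move=> nfin.
have /choice [F FP] : forall s : seq G,
    exists g, forall h, h \in s -> ~ frame M h g.
  move=> s; apply: contrapT => /forallNP nog; apply: nfin.
  exists [set` s]; split; first exact: finite_seq.
  move=> g; have /existsNP [h /not_implyP [hs /contrapT fr]] := nog g.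
  by exists h.
pose L := fix L n := if n is m.+1 then F (L m) :: L m else [::].
exists (F \o L) => m n mn; apply: FP.
by elim: n mn => // n IHn; rewrite ltnS leq_eqVlt inE => /predU1P[-> | /IHn ->];
  rewrite ?eqxx ?orbT.
Qed.

Theorem stationary_finite_type :
  (forall u : nat -> G, exists2 f : nat -> nat, forall n, f n < f n.+1 &
     forall n, preceq (u (f n)) (u (f n.+1))) ->
  (forall (g : nat -> G) (gS : forall i, preceq (g i) (g i.+1)),
     becomes_stationary M gS) ->
  finite_type M.
Proof.
move=> wqo stat; apply: contrapT => /nonframed_sequence [u uP].
have [f fS fP] := wqo u.
have /choice [w wP] : forall n, exists w, [/\ preceq (u (f n)) w,
    preceq w (u (f n.+1)) & ~ iso_between (u (f n)) w].
  by move=> n; apply: nonframe_witness => //; exact: uP.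
pose g n := if odd n then w n./2 else u (f n./2).
have gS n : preceq (g n) (g n.+1).
  rewrite /g /= uphalf_half; case: (odd n) => /=.
    by rewrite add1n; have [] := wP n./2.
  by rewrite add0n; have [] := wP n./2.
have [D DP] := stat g gS.
have D2 : D <= D.*2 by rewrite -addnn leq_addr.
have := is_iso_between (DP _ D2).
by rewrite /g /= odd_double uphalf_double doubleK; have [] := wP D.
Qed.

End PersistenceModule.

Theorem lemma16 (R : pzRingType) (k : nat) (M : gapm R {ffun 'I_k -> nat}) :
  finite_type M <->
  (forall (g : nat -> {ffun 'I_k -> nat})
          (gS : forall i : nat, preceq (g i) (g i.+1)),
     becomes_stationary M gS).
Proof.
split; first exact: finite_type_stationary.
exact/stationary_finite_type/dickson.
Qed.
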